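(* Let $p=2$. There are constants $\alpha>0$ and $N_0$, independent of $N$, such that for every $N\ge N_0$ and every polynomial $g\in\mathbb{F}_2[x_1,\dots,x_N]$ of degree at most $3$, $$|\langle S_4,g\rangle|<\exp\{-\alpha N\},$$ where $S_4(x)=\sum_{T\subseteq[N],\,|T|=4}\prod_{i\in T}x_i$.
   Context: For $f,g:\mathbb{F}_2^N\to\mathbb{F}_2$, $\langle f,g\rangle=\mathbb{E}_{x\in\mathbb{F}_2^N}(-1)^{f(x)-g(x)}$. *)

(* Defs.v *)
From HB Require Import structures.
From mathcomp Require Import all_boot all_order all_algebra.
From mathcomp Require Import all_classical all_reals all_analysis.
From mathcomp Require mpoly.
Set Implicit Arguments. Unset Strict Implicit. Unset Printing Implicit Defensive.
Import Order.TTheory GRing.Theory Num.Theory.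
Local Open Scope ring_scope.

Definition pt (N : nat) := {ffun 'I_N -> 'F_2}.

Definition sgnF2 (R : realType) (b : 'F_2) : R := if b == 0 then 1 else -1.

Definition corr (R : realType) (N : nat) (f g : pt N -> 'F_2) : R :=
  (#|{: pt N}|%:R)^-1 * \sum_(x : pt N) sgnF2 R (f x - g x).

Definition S4 (N : nat) (x : pt N) : 'F_2 :=
  \sum_(T : {set 'I_N} | #|T| == 4%N) \prod_(i in T) x i.

(* Total degree of a multivariate polynomial: the largest total degree
   (mdeg) of a monomial in its support (0 for the zero polynomial). *)
Definition mdegree (N : nat) (g : mpoly.mpoly N 'F_2) : nat :=
  (\max_(m <- mpoly.msupp g) mpoly.mdeg m)%N.

Definition peval (N : nat) (g : mpoly.mpoly N 'F_2) (x : pt N) : 'F_2 :=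
  mpoly.meval (fun i => x i) g.

(* Main.v *)
Require Import Defs.
From HB Require Import structures.
From mathcomp Require Import all_boot all_order all_algebra.
From mathcomp Require Import all_classical all_reals all_analysis.
From mathcomp Require mpoly.
From mathcomp Require Import ring lra zify.
Set Implicit Arguments. Unset Strict Implicit. Unset Printing Implicit Defensive.
Import Order.TTheory GRing.Theory Num.Theory.
Local Open Scope ring_scope.

(* Restrict S_4 - g to a translate of the space of even-weight vectors and apply
   Cauchy-Schwarz three times. For even y, z, w the third derivative of S_4 at x
   has x-linear part <x,y><z,w> + <x,z><y,w> + <x,w><y,z>, so, up to O(1/M) with
   M = 2^N, only triples with <y,z> = <y,w> = <z,w> = 0 contribute to the average
   over x. On those the third derivative of S_4 - g is the trilinear form
   f(y,z,w) = sum_i y_i z_i w_i - T(y,z,w), where T = D_y D_z D_w g is alternating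
   because deg g <= 3. It remains to bound the number K of pairs with
   f(y,z,.) = 0. Regard f as a commutative product y.z with values in linear
   functionals; then y.y = <y,.>, which determines y up to O(1) choices. If
   y.z = y.w = z.w = 0 then (y+z).(y+w) = <y,.>, so there are only O(M^2) such
   triangles; since kernels are subgroups there are at least K^3/M^3 of them.
   Hence K = O(M^(5/3)), and the correlation is O(M^(-1/24)). *)

(** * Kernels and triangles of a symmetric bilinear map *)

Lemma sqr_sum_le (R : realDomainType) (I : finType) (a : I -> R) :
  (\sum_i a i) ^+ 2 <= #|I|%:R * \sum_i a i ^+ 2.
Proof.
rewrite -(@ler_pMn2r _ 2) //.
have -> : (#|I|%:R * \sum_i a i ^+ 2) *+ 2 =
    \sum_i \sum_j (a i ^+ 2 + a j ^+ 2).
  under [RHS]eq_bigr => i _ do rewrite big_split /= sumr_const.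
  by rewrite big_split /= sumr_const sumrMnl mulr2n mulr_natl.
rewrite expr2 big_distrlr /= -sumrMnl; apply: ler_sum => i _.
rewrite -sumrMnl; apply: ler_sum => j _.
by rewrite -subr_ge0 (_ : _ - _ = (a i - a j) ^+ 2) ?sqr_ge0 //; ring.
Qed.

Lemma sqr_sumn_le (I : finType) (a : I -> nat) :
  ((\sum_i a i) ^ 2 <= #|I| * \sum_i a i ^ 2)%N.
Proof.
have := @sqr_sum_le int I (fun i => (a i)%:R).
under [X in _ <= _ * X]eq_bigr => i _ do rewrite -natrX.
by rewrite -!natr_sum -natrX -natrM ler_nat.
Qed.

(** A nonempty fibre is a translate of the kernel. *)
Lemma fibre_le_kernel (V : finZmodType) (A : zmodType) (phi : V -> A) (c : A) :
  {morph phi : x y / x + y} ->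
  (\sum_z (phi z == c) <= \sum_z (phi z == 0%R))%N.
Proof.
move=> phiD; rewrite -!big_mkcond !sum1_card.
have phiN x y : phi (x - y) = phi x - phi y.
  by apply: (addIr (phi y)); rewrite -phiD !subrK.
have [/existsP[z0 /eqP h0]|/existsPn h] := boolP [exists z, phi z == c].
  rewrite -(fintype.card_image (addIr (- z0))) subset_leq_card //.
  apply/fintype.subsetP => x /fintype.imageP[z]; rewrite !unfold_in => /eqP hz ->.
  by rewrite phiN hz h0 subrr; exact: eqxx.
by rewrite eq_card0 // => x; rewrite unfold_in; apply/negbTE/h.
Qed.

(** Replace the second variable by [v - h] and group by [v]: the remaining [h] form the fibre of
    [(phi, psi)] over [(0, psi v)], no larger than the joint kernel. *)
Lemma kernel_meet (V : finZmodType) (A B : zmodType)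
    (phi : V -> A) (psi : V -> B) :
  {morph phi : x y / x + y} -> {morph psi : x y / x + y} ->
  ((\sum_z (phi z == 0%R)) * (\sum_z (psi z == 0%R)) <=
     #|V| * \sum_z ((phi z == 0%R) && (psi z == 0%R)))%N.
Proof.
move=> phiD psiD.
have psiN x y : psi (x - y) = psi x - psi y.
  by apply: (addIr (psi y)); rewrite -psiD !subrK.
rewrite big_distrl /=.
under eq_bigr => h _.
  rewrite big_distrr /= (reindex_inj (addrI (- h))) /=.
  under eq_bigr => v _ do rewrite addrC psiN subr_eq0 mulnb (eq_sym (psi v)).
  over.
rewrite exchange_big /= -sum_nat_const; apply: leq_sum => v _.
under eq_bigr => z _ do rewrite -xpair_eqE.
under [X in (_ <= X)%N]eq_bigr => z _ do rewrite -xpair_eqE.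
by apply: fibre_le_kernel => x y; rewrite phiD psiD.
Qed.

Section Triangles.
Variables (V : finZmodType) (A : zmodType) (mu : V -> V -> A).
Hypothesis muC : forall y z, mu y z = mu z y.
Hypothesis muD : forall y, {morph mu y : z w / z + w}.

Let k y : nat := \sum_z (mu y z == 0%R).
Let K : nat := \sum_y k y.

Let tri y z w := [&& mu y z == 0, mu y w == 0 & mu z w == 0].

(** [kernel_meet] is used twice: summed over all [w], it shows that [k] averages at least [K / #|V|]
    on the kernel of [y]; then it applies to each [z] in that kernel. *)
Lemma triangles_at_ge y :
  (k y ^ 2 * K <= #|V| ^ 2 * \sum_z \sum_w tri y z w)%N.
Proof.
have step1 z : (k y * k z <=
    #|V| * \sum_w ((mu y w == 0%R) && (mu z w == 0%R)))%N.
  exact: kernel_meet.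
have step2 : (k y * K <= #|V| * \sum_z (mu y z == 0%R) * k z)%N.
  rewrite /K; under [X in (_ <= _ * X)%N]eq_bigr => z _ do rewrite big_distrr /=.
  rewrite [X in (_ <= _ * X)%N]exchange_big /= !big_distrr /=; apply: leq_sum => w _.
  apply: leq_trans (step1 w) _; rewrite leq_mul2l; apply/orP; right.
  by apply: leq_sum => z _; rewrite mulnb (muC z w).
rewrite !expnS !expn0 !muln1 -!mulnA.
apply: (@leq_trans (k y * (#|V| * \sum_z (mu y z == 0%R) * k z))%N).
  by rewrite leq_mul2l step2 orbT.
rewrite mulnCA leq_mul2l; apply/orP; right.
rewrite !big_distrr /=; apply: leq_sum => z _.
rewrite mulnCA /tri; case: (mu y z == 0%R) => /=; last by rewrite mul0n.
by rewrite mul1n step1.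
Qed.

Variables (beta : V -> A) (r : nat).
Hypothesis V_char2 : forall x : V, x + x = 0.
Hypothesis mu_diag : forall y, mu y y = beta y.
Hypothesis beta_fibre : forall c, (\sum_y (beta y == c) <= r)%N.

(* Whenever [y], [z], [w] annihilate each other, [mu (y + z) (y + w)] equals
   [beta y]: a triangle is recovered, up to [r] choices, from two vectors. *)
Lemma triangles_le : (\sum_y \sum_z \sum_w tri y z w <= r * #|V| ^ 2)%N.
Proof.
under eq_bigr => y _.
  rewrite (reindex_inj (addrI y)) /=.
  under eq_bigr => z _ do rewrite (reindex_inj (addrI y)) /=.
  over.
rewrite exchange_big /=; under eq_bigr => a _ do rewrite exchange_big /=.
rewrite expnS expn1 mulnCA -sum_nat_const; apply: leq_sum => a _.
rewrite mulnC -sum_nat_const; apply: leq_sum => b _.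
apply: leq_trans (beta_fibre (mu a b)); apply: leq_sum => y _.
case: (boolP (tri _ _ _)) => // /and3P[/eqP h1 /eqP h2 /eqP h3].
have yK (x : V) : x = (y + x) + y by rewrite addrAC V_char2 add0r.
have -> : mu a b = mu (y + a + y) (y + b + y) by rewrite -!yK.
rewrite muD [mu _ (y + b)]muC muD [mu _ (y + a)]muC h3 [mu _ y]muC h2.
by rewrite [mu (_ + y) y]muC muD h1 mu_diag !add0r eqxx.
Qed.

(** Cauchy-Schwarz over [y] turns [triangles_at_ge] into a lower bound for the number of triangles,
    to be compared with [triangles_le]. *)
Lemma annihilating_pairs_le : (K ^ 3 <= r * #|V| ^ 5)%N.
Proof.
have h1 : (K ^ 2 <= #|V| * \sum_y k y ^ 2)%N by exact: sqr_sumn_le.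
have h2 : ((\sum_y k y ^ 2) * K <= #|V| ^ 2 * \sum_y \sum_z \sum_w tri y z w)%N.
  rewrite big_distrl big_distrr /=; apply: leq_sum => y _.
  exact: triangles_at_ge.
rewrite expnSr; apply: (leq_trans (leq_mul h1 (leqnn K))).
rewrite -mulnA; apply: (leq_trans (leq_mul (leqnn _) h2)).
rewrite mulnA.
apply: (leq_trans (leq_mul (leqnn _) triangles_le)).
by rewrite mulnCA leq_mul2l; apply/orP; right; rewrite !expnS expn0 !muln1 !mulnA.
Qed.

(** For fixed [y], [c1 y] only selects a fibre of an additive map in [z]; then, for fixed [z], so
    does [c2 z] in [y]. *)
Lemma twisted_pairs_le (c1 c2 : V -> A) :
  {morph c1 : x y / x + y} -> {morph c2 : x y / x + y} ->
  (\sum_y \sum_z (mu y z == (c1 y + c2 z)%R) <= K)%N.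
Proof.
move=> c1D c2D.
apply: (@leq_trans (\sum_y \sum_z ((mu y z - c2 z)%R == 0%R))%N).
  apply: leq_sum => y _.
  under eq_bigr => z _ do rewrite -subr_eq.
  apply: fibre_le_kernel => z w; rewrite muD c2D opprD; exact: addrACA.
rewrite exchange_big /=; apply: leq_sum => z _.
under eq_bigr => y _ do rewrite subr_eq0 muC.
exact: fibre_le_kernel.
Qed.
End Triangles.

(** * Character sums *)

(* Makes [pt N] a [finZmodType]. *)
HB.saturate finfun_of.

Lemma F2_cases (a : 'F_2) : a = 0 \/ a = 1.
Proof. by case: a => [[|[|//]] h]; [left|right]; apply/val_inj. Qed.

Lemma F2_neq0 (a : 'F_2) : a != 0 -> a = 1.
Proof. by case: (F2_cases a) => ->; rewrite ?eqxx. Qed.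

Lemma addF2 (a : 'F_2) : a + a = 0.
Proof. by apply/val_inj; case: (F2_cases a) => ->. Qed.

Lemma oppF2 (a : 'F_2) : - a = a.
Proof. by apply/eqP; rewrite eq_sym -addr_eq0 addF2. Qed.

Lemma big_F2 (R : nmodType) (g : 'F_2 -> R) : \sum_a g a = g 0 + g 1.
Proof.
by rewrite (bigD1 0) //= (big_pred1 1) // => a; case: (F2_cases a) => ->.
Qed.

Definition dder (U : zmodType) (F : U -> 'F_2) (y x : U) : 'F_2 := F (x + y) - F x.

Section Signs.
Variable R : realType.
Local Notation s := (sgnF2 R).

Lemma sgnF2_0 : s 0 = 1. Proof. by rewrite /sgnF2 eqxx. Qed.
Lemma sgnF2_1 : s 1 = -1. Proof. by []. Qed.

Lemma sgnF2D a b : s (a + b) = s a * s b.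
Proof.
case: (F2_cases a) => ->; first by rewrite add0r sgnF2_0 mul1r.
case: (F2_cases b) => ->; first by rewrite addr0 sgnF2_0 mulr1.
by rewrite addF2 sgnF2_0 sgnF2_1 mulrNN mulr1.
Qed.

Lemma sgnF2N a : s (- a) = s a. Proof. by rewrite oppF2. Qed.

Lemma normr_sgnF2 a : `|s a| = 1.
Proof. by rewrite /sgnF2; case: ifP; rewrite ?normrN normr1. Qed.

Lemma sgnF2_indicator a : (a == 0)%:R = (\sum_(c : 'F_2) s (c * a)) / 2 :> R.
Proof.
rewrite big_F2 mul0r mul1r sgnF2_0.
by case: (F2_cases a) => ->; rewrite ?eqxx ?sgnF2_0 ?sgnF2_1 /=; lra.
Qed.

Variable V : finZmodType.

Definition csum (F : V -> 'F_2) : R := \sum_x s (F x).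

(** Translating by a point where [chi] is 1 negates the sum. *)
Lemma csum_additive (chi : V -> 'F_2) : {morph chi : x y / x + y} ->
  csum chi = #|V|%:R * ([ffun x => chi x] == 0)%:R.
Proof.
move=> chiD; case: eqP => [/ffunP h|h].
  rewrite /csum (eq_bigr (fun=> 1)) ?sumr_const ?mulr1 // => x _.
  by have := h x; rewrite !ffunE => ->; rewrite sgnF2_0.
have /existsP[x0 hx0] : [exists x, chi x != 0].
  apply: contraT => /existsPn h0; case: h; apply/ffunP => x; rewrite !ffunE.
  by apply/eqP; rewrite -[_ == _]negbK.
have : csum chi = - csum chi.
  rewrite {1}/csum (reindex_inj (addIr x0)) /= -sumrN; apply: eq_bigr => x _.
  by rewrite chiD sgnF2D (F2_neq0 hx0) sgnF2_1 mulrN1.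
by move=> h1; rewrite mulr0; lra.
Qed.

Lemma csum_sqr F : csum F ^+ 2 = \sum_y csum (dder F y).
Proof.
rewrite expr2 /csum big_distrlr /= [RHS]exchange_big /=; apply: eq_bigr => x _.
rewrite (reindex_inj (addrI x)) /=; apply: eq_bigr => y _.
by rewrite /dder sgnF2D sgnF2N mulrC.
Qed.

(** After normalization, a mean is bounded by a Gowers U^3 norm: [csum_sqr] trades a square for a
    derivative, and Cauchy-Schwarz moves the next square inside. *)
Lemma csum_pow8_le F : csum F ^+ 8 <=
  #|V|%:R ^+ 4 * \sum_y \sum_z \sum_w csum (dder (dder (dder F y) z) w).
Proof.
have h4 : csum F ^+ 4 <= #|V|%:R * \sum_y \sum_z csum (dder (dder F y) z).
  rewrite (exprM _ 2 2) csum_sqr; apply: le_trans (sqr_sum_le _) _.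
  by rewrite (eq_bigr _ (fun y _ => csum_sqr _)).
have := h4; rewrite -ler_sqr ?nnegrE.
- rewrite -exprM => /le_trans; apply; rewrite exprMn.
  have -> : #|V|%:R ^+ 4 = #|V|%:R ^+ 2 * (#|V|%:R * #|V|%:R) :> R by ring.
  rewrite -(mulrA (_ ^+ 2)) ler_wpM2l ?exprn_ge0 // -mulrA.
  apply: le_trans (sqr_sum_le _) _; rewrite ler_wpM2l // mulr_sumr.
  apply: ler_sum => y _; apply: le_trans (sqr_sum_le _) _.
  by rewrite (eq_bigr _ (fun y _ => csum_sqr _)).
- by rewrite (exprM _ 2 2) sqr_ge0.
- by apply: le_trans h4; rewrite (exprM _ 2 2) sqr_ge0.
Qed.
End Signs.

(** * Sign sums of a function with prescribed third derivative *)

Section QuarticSum.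
Variables (R : realType) (V : finZmodType).
Variables (B : V -> V -> 'F_2) (f Phi : V -> V -> V -> 'F_2) (F : V -> 'F_2).
Variable r : nat.
Hypothesis V_char2 : forall x : V, x + x = 0.
Hypothesis BC : forall x y, B x y = B y x.
Hypothesis BD : forall x, {morph B x : y z / y + z}.
Hypothesis B_fibre : forall c : {ffun V -> 'F_2},
  (\sum_y ([ffun x => B y x] == c) <= r)%N.
Hypothesis fC : forall y z w, f y z w = f z y w.
Hypothesis fD2 : forall y w, {morph (f y)^~ w : z z' / z + z'}.
Hypothesis fD3 : forall y z, {morph f y z : w w' / w + w'}.
Hypothesis f_diag : forall y w, f y y w = B y w.
Hypothesis F_der3 : forall x y z w,
  dder (dder (dder F y) z) w x =
  Phi y z w + (B x y * B z w + B x z * B y w + B x w * B y z).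
Hypothesis Phi_f : forall y z w,
  B y z = 0 -> B y w = 0 -> B z w = 0 -> Phi y z w = f y z w.

Local Notation s := (sgnF2 R).
Local Notation M := (#|V|%:R : R).

Let mu y z : {ffun V -> 'F_2} := [ffun w => f y z w].
Let beta y : {ffun V -> 'F_2} := [ffun x => B y x].
Let lin y z w : {ffun V -> 'F_2} :=
  [ffun x => B x y * B z w + B x z * B y w + B x w * B y z].
Let K : nat := \sum_y \sum_z (mu y z == 0%R).
(** The error triples of the average over [x]. Only one pairing is tested; permuted arguments cover
    the other two. *)
Let bad y z w : bool := (B z w != 0) && (lin y z w == 0).

Let muC y z : mu y z = mu z y.
Proof. by apply/ffunP => w; rewrite !ffunE fC. Qed.

Let muD y : {morph mu y : z w / z + w}.
Proof. by move=> z w; apply/ffunP => u; rewrite !ffunE fD2. Qed.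

Let K_le : (K ^ 3 <= r * #|V| ^ 5)%N.
Proof.
apply: (annihilating_pairs_le muC muD V_char2 (beta := beta)) => // y.
by apply/ffunP => w; rewrite !ffunE f_diag.
Qed.

(** When [B z w = 1], vanishing of [lin] makes [beta y] a combination of [beta z] and [beta w]; each
    of the four coefficient pairs leaves at most [r] choices of [y]. *)
Let bad_count : (\sum_y \sum_z \sum_w bad y z w <= 4 * r * #|V| ^ 2)%N.
Proof.
rewrite exchange_big /=; under eq_bigr => z _ do rewrite exchange_big /=.
rewrite expnS expn1 mulnCA -sum_nat_const; apply: leq_sum => z _.
rewrite mulnC -sum_nat_const; apply: leq_sum => w _.
apply: (@leq_trans (\sum_y \sum_(a : 'F_2) \sum_(b : 'F_2)
    (beta y == [ffun x => a * B x z + b * B x w]%R))%N).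
  apply: leq_sum => y _; case: (boolP (bad y z w)) => //.
  case/andP => /F2_neq0 h1 /eqP/ffunP h2.
  rewrite (bigD1 (B y w)) //= (bigD1 (B y z)) //=.
  suff -> : beta y == [ffun x => B y w * B x z + B y z * B x w]%R by [].
  apply/eqP/ffunP => x; have := h2 x; rewrite !ffunE h1 mulr1 -addrA (BC x y).
  by move=> /eqP; rewrite addr_eq0 oppF2 => /eqP ->; ring.
rewrite exchange_big /=; under eq_bigr => a _ do rewrite exchange_big /=.
apply: (@leq_trans (\sum_(a : 'F_2) \sum_(b : 'F_2) r)%N).
  by do 2!(apply: leq_sum => ? _); exact: B_fibre.
by rewrite !sum_nat_const card_Fp // !mulnA.
Qed.

(** The third derivative is a constant plus an additive function of [x], so its sum is 0 or [M] up
    to sign. *)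
Let der3_sum y z w : csum R (dder (dder (dder F y) z) w) <=
  M * ([&& B y z == 0, B y w == 0 & B z w == 0]%:R * s (f y z w)
       + ((bad y z w)%:R + (bad z y w)%:R + (bad w y z)%:R)).
Proof.
have linC1 : lin z y w = lin y z w by apply/ffunP => x; rewrite !ffunE (BC z y); ring.
have linC2 : lin w y z = lin y z w.
  by apply/ffunP => x; rewrite !ffunE (BC w y) (BC w z); ring.
have -> : csum R (dder (dder (dder F y) z) w) =
    s (Phi y z w) * (M * (lin y z w == 0)%:R).
  rewrite -csum_additive; last first.
    by move=> x x'; rewrite !(BC (_ + _)) !BD !(BC x) !(BC x'); ring.
  by rewrite /csum mulr_sumr; apply: eq_bigr => x _; rewrite F_der3 sgnF2D.
rewrite mulrCA ler_wpM2l // /bad linC1 linC2.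
have sle a : s a <= 1 by rewrite -(normr_sgnF2 R a) ler_norm.
(* Seven of the eight cases close here; the one with all pairings zero remains. *)
have [h1|h1] := eqVneq (B y z) 0; have [h2|h2] := eqVneq (B y w) 0;
  have [h3|h3] := eqVneq (B z w) 0; rewrite /= ?mul0r ?add0r;
  try by case: (lin y z w == 0); rewrite /= ?mulr0 ?mulr1 ?addr0 ?add0r //;
         have := sle (Phi y z w); lra.
have -> : lin y z w = 0 by apply/ffunP => x; rewrite !ffunE h1 h2 h3 !mulr0 !addr0.
by rewrite Phi_f // eqxx !addr0 mulr1 mul1r.
Qed.

(** Expanding the two conditions on [w] in characters leaves, for each [(a, b)], the character sum
    of an additive function of [w]. *)
Let main_pair y z :
  \sum_w [&& B y z == 0, B y w == 0 & B z w == 0]%:R * s (f y z w) <=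
  (M / 4) * \sum_(a : 'F_2) \sum_(b : 'F_2)
    (mu y z == [ffun w => a * B y w] + [ffun w => b * B z w])%:R.
Proof.
have e : \sum_w ((B y w == 0)%:R * (B z w == 0)%:R) * s (f y z w) =
  (M / 4) * \sum_(a : 'F_2) \sum_(b : 'F_2)
    (mu y z == [ffun w => a * B y w] + [ffun w => b * B z w])%:R.
  transitivity (4^-1 * \sum_(a : 'F_2) \sum_(b : 'F_2)
      csum R (fun w => f y z w + (a * B y w + b * B z w))).
    rewrite /csum; under [in RHS]eq_bigr => a _ do rewrite exchange_big /=.
    rewrite exchange_big mulr_sumr /=; apply: eq_bigr => w _.
    by rewrite !sgnF2_indicator !big_F2 !sgnF2D; field.
  rewrite [M / 4]mulrC -mulrA; congr (_ * _); rewrite mulr_sumr.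
  apply: eq_bigr => a _; rewrite mulr_sumr; apply: eq_bigr => b _.
  rewrite csum_additive => [|w w']; last by rewrite fD3 !BD; ring.
  congr (_ * _%:R); rewrite -[in RHS]subr_eq0; congr (nat_of_bool (_ == _)).
  by apply/ffunP => w; rewrite !ffunE oppF2.
(* Nonnegativity settles the pairs with [B y z] nonzero, whose left side is 0. *)
have ge0 : 0 <= (M / 4) * \sum_(a : 'F_2) \sum_(b : 'F_2)
    (mu y z == [ffun w => a * B y w] + [ffun w => b * B z w])%:R.
  by rewrite mulr_ge0 ?divr_ge0 // sumr_ge0 // => a _; rewrite sumr_ge0.
case: (B y z == 0) => /=; last by rewrite big1 // => w _; rewrite mul0r.
by rewrite -e le_eqVlt; apply/orP; left; apply/eqP; apply: eq_bigr => w _; rewrite -mulnb natrM.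
Qed.

Let main_sum :
  \sum_y \sum_z \sum_w
     [&& B y z == 0, B y w == 0 & B z w == 0]%:R * s (f y z w) <= M * K%:R.
Proof.
apply: (@le_trans _ _ (\sum_y \sum_z (M / 4) * \sum_(a : 'F_2) \sum_(b : 'F_2)
    (mu y z == [ffun w => a * B y w] + [ffun w => b * B z w])%:R)).
  by apply: ler_sum => y _; apply: ler_sum => z _; exact: main_pair.
(* Each of the four twists contributes at most [K], which cancels the factor 1/4. *)
have tw (a b : 'F_2) : \sum_y \sum_z
    (mu y z == [ffun w => a * B y w] + [ffun w => b * B z w])%:R <= K%:R :> R.
  apply: (@le_trans _ _ (\sum_y \sum_z
      (mu y z == ([ffun w => a * B y w] + [ffun w => b * B z w])%R))%N%:R).
    by rewrite natr_sum; apply: ler_sum => y _; rewrite natr_sum.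
  rewrite ler_nat; apply: twisted_pairs_le => // y y'; apply/ffunP => w;
  by rewrite !ffunE !(BC _ w) BD; ring.
have tw' := (tw 0 0, tw 0 1, tw 1 0, tw 1 1).
under eq_bigr => y _.
  rewrite -mulr_sumr.
  under eq_bigr => z _ do rewrite !big_F2.
  rewrite !big_split /=; over.
rewrite -mulr_sumr !big_split /= -mulrA ler_wpM2l //.
case: tw' => [[[t1 t2] t3] t4]; lra.
Qed.

(** The 12 is three orders of error triples times the 4 of [bad_count]. Bounding [K] through its
    cube avoids roots. *)
Lemma quartic_sum_bound : exists K : nat, (K ^ 3 <= r * #|V| ^ 5)%N /\
  csum R F ^+ 8 <= M ^+ 6 * (K%:R + 12 * r%:R * M).
Proof.
exists K; split => //; apply: le_trans (csum_pow8_le _ _) _.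
have -> : M ^+ 6 * (K%:R + 12 * r%:R * M) =
   M ^+ 4 * (M * (M * K%:R + 3 * (4 * r%:R * M ^+ 2))) by ring.
rewrite ler_wpM2l ?exprn_ge0 //.
pose g y z w : R := (bad y z w)%:R.
have gs : \sum_y \sum_z \sum_w g y z w <= 4 * r%:R * M ^+ 2.
  apply: (@le_trans _ _ (\sum_y \sum_z \sum_w bad y z w)%N%:R).
    rewrite natr_sum; apply: ler_sum => y _.
    by rewrite natr_sum; apply: ler_sum => z _; rewrite natr_sum.
  by rewrite -natrX -!natrM ler_nat.
have gs2 : \sum_y \sum_z \sum_w g z y w <= 4 * r%:R * M ^+ 2.
  by rewrite exchange_big.
have gs3 : \sum_y \sum_z \sum_w g w y z <= 4 * r%:R * M ^+ 2.
  under eq_bigr => y _ do rewrite exchange_big /=.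
  by rewrite exchange_big.
apply: (@le_trans _ _ (\sum_y \sum_z \sum_w
  (M * ([&& B y z == 0, B y w == 0 & B z w == 0]%:R * s (f y z w)
       + (g y z w + g z y w + g w y z))))).
  by do 3!(apply: ler_sum => ? _); exact: der3_sum.
under eq_bigr => y _.
  under eq_bigr => z _ do rewrite -mulr_sumr !big_split /=.
  rewrite -mulr_sumr !big_split /=; over.
rewrite -mulr_sumr !big_split /= ler_wpM2l //.
have := main_sum; lra.
Qed.
End QuarticSum.

(** * The third derivative of S_4 *)

Lemma bin2_double m : (2 * 'C(m, 2) + m = m * m)%N.
Proof. by elim: m => // m IH; rewrite binS bin1; lia. Qed.

Lemma F2_nat_odd n : n%:R = (odd n)%:R :> 'F_2.
Proof.
rewrite -[in LHS](odd_double_half n) natrD -mul2n natrM.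
by rewrite (_ : 2%:R = 0 :> 'F_2) ?mul0r ?addr0 //; apply/val_inj.
Qed.

Lemma F2_natr_eq m n : odd m = odd n -> m%:R = n%:R :> 'F_2.
Proof. by rewrite F2_nat_odd => ->; rewrite -F2_nat_odd. Qed.

Lemma F2_natr_nat (a : 'F_2) : (nat_of_ord a)%:R = a.
Proof. by case: (F2_cases a) => ->; apply/val_inj. Qed.

(** By Lucas, both sides are the bit of value 4 in [k]. This makes [S4] quadratic in the half
    weight. *)
Lemma odd_bin4 k : odd 'C(k, 4) = odd 'C(k./2, 2).
Proof.
rewrite -[in LHS](odd_double_half k) -mul2n; move: (odd k) (k./2) => b m.
elim: m => [|m IH]; first by case: b.
have -> : (b + 2 * m.+1 = (b + 2 * m).+2)%N by lia.
rewrite !binS bin1; have := bin2_double (b + 2 * m); have := bin2_double m.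
case: b IH => /=; rewrite ?binS ?bin1; lia.
Qed.

(* Applied with [m = hw x], [n1 = hw (x + y)], ..., [n123 = hw (x + y + z + w)].
   The even summands [u * u + u] make the difference of the two sides twice a
   polynomial with integer coefficients, which is what lets [lia] conclude. *)
Lemma third_difference_bin2 (m n1 n2 n3 n12 n13 n23 n123 : nat)
    (a b c d e f X Y Z t t1 t2 t3 q : nat) :
  (n1 + X = m + a)%N -> (n2 + Y = m + b)%N -> (n3 + Z = m + c)%N ->
  (n12 + d + X + Y = m + a + b + 2 * t1)%N ->
  (n13 + e + X + Z = m + a + c + 2 * t2)%N ->
  (n23 + f + Y + Z = m + b + c + 2 * t3)%N ->
  (n123 + d + e + f + X + Y + Z + 4 * q =
     m + a + b + c + 2 * (t + t1 + t2 + t3))%N ->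
  odd ('C(m, 2) + 'C(n1, 2) + 'C(n2, 2) + 'C(n3, 2) + 'C(n12, 2)
    + 'C(n13, 2) + 'C(n23, 2) + 'C(n123, 2)) =
  odd (t + (c + Z) * d + (b + Y) * e + (a + X) * f + d * e + d * f + e * f
    + (d * d + d) + (e * e + e) + (f * f + f)).
Proof.
move=> h1 h2 h3 h12 h13 h23 h123.
have := bin2_double m; have := bin2_double n1; have := bin2_double n2.
have := bin2_double n3; have := bin2_double n12; have := bin2_double n13.
have := bin2_double n23; have := bin2_double n123.
move: 'C(m,2) 'C(n1,2) 'C(n2,2) 'C(n3,2) 'C(n12,2) 'C(n13,2) 'C(n23,2) 'C(n123,2).
move=> C0 C1 C2 C3 C4 C5 C6 C7 E7 E6 E5 E4 E3 E2 E1 E0.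
have odd_eq (l r : nat) :
  Posz l = Posz r + 2 * ((Posz l - Posz r) %/ 2)%Z -> odd l = odd r by lia.
apply: odd_eq; rewrite !PoszD !PoszM.
have e1 : Posz n1 = m%:Z + a%:Z - X%:Z by lia.
have e2 : Posz n2 = m%:Z + b%:Z - Y%:Z by lia.
have e3 : Posz n3 = m%:Z + c%:Z - Z%:Z by lia.
have e4 : Posz n12 = m%:Z + a%:Z + b%:Z + 2 * t1%:Z - d%:Z - X%:Z - Y%:Z by lia.
have e5 : Posz n13 = m%:Z + a%:Z + c%:Z + 2 * t2%:Z - e%:Z - X%:Z - Z%:Z by lia.
have e6 : Posz n23 = m%:Z + b%:Z + c%:Z + 2 * t3%:Z - f%:Z - Y%:Z - Z%:Z by lia.
have e7 : Posz n123 = m%:Z + a%:Z + b%:Z + c%:Z + 2 * (t%:Z + t1%:Z + t2%:Z + t3%:Z)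
    - d%:Z - e%:Z - f%:Z - X%:Z - Y%:Z - Z%:Z - 4 * q%:Z by lia.
have D1 := congr1 Posz E1; have D2 := congr1 Posz E2; have D3 := congr1 Posz E3.
have D4 := congr1 Posz E4; have D5 := congr1 Posz E5; have D6 := congr1 Posz E6.
have D7 := congr1 Posz E7.
rewrite !PoszD !PoszM ?(e1, e2, e3, e4, e5, e6, e7) in D1 D2 D3 D4 D5 D6 D7.
clear E1 E2 E3 E4 E5 E6 E7 e1 e2 e3 e4 e5 e6 e7 h1 h2 h3 h12 h13 h23 h123.
lia.
Qed.

Section Weights.
Variable N : nat.
Implicit Types x y z w : pt N.

(** Sizes are natural numbers, not elements of ['F_2], since [S4] depends on the weight modulo 8. *)
Definition wt x : nat := (\sum_i x i)%N.
Definition hw x : nat := (wt x)./2.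
Definition ip x y : nat := (\sum_i x i * y i)%N.
Definition tp x y z : nat := (\sum_i x i * y i * z i)%N.

Lemma F2_natD (a b : 'F_2) : ((a + b)%R + 2 * (a * b) = a + b :> nat)%N.
Proof. by case: (F2_cases a) => ->; case: (F2_cases b) => ->. Qed.

Lemma wtD x y : (wt (x + y)%R + 2 * ip x y = wt x + wt y)%N.
Proof.
rewrite big_distrr -!big_split /=; apply: eq_bigr => i _.
by rewrite ffunE F2_natD.
Qed.

Lemma ipD x y z : (ip x (y + z)%R + 2 * tp x y z = ip x y + ip x z)%N.
Proof.
rewrite big_distrr -!big_split /=; apply: eq_bigr => i _.
by rewrite ffunE -mulnDr -(F2_natD (y i)) mulnDr (mulnCA _ 2%N) !mulnA.
Qed.

Lemma tpD x y z w :
  (tp x y (z + w)%R + 2 * \sum_i x i * y i * (z i * w i) = tp x y z + tp x y w)%N.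
Proof.
rewrite big_distrr -!big_split /=; apply: eq_bigr => i _.
by rewrite ffunE -mulnDr -(F2_natD (z i)) mulnDr (mulnCA _ 2%N).
Qed.

Lemma wt_evenD x y : ~~ odd (wt x) -> ~~ odd (wt y) -> ~~ odd (wt (x + y)).
Proof. have := wtD x y; lia. Qed.

(** Evenness of [y] gives [x] and [x + y] weights of equal parity, so both halvings round alike. *)
Lemma hwD x y : ~~ odd (wt y) -> (hw (x + y)%R + ip x y = hw x + hw y)%N.
Proof. rewrite /hw; have := wtD x y; lia. Qed.

Definition dot x y : 'F_2 := \sum_i x i * y i.
Definition tdot x y z : 'F_2 := \sum_i x i * y i * z i.

Lemma ip_dot x y : (ip x y)%:R = dot x y.
Proof.
by rewrite natr_sum; apply: eq_bigr => i _; rewrite natrM !F2_natr_nat.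
Qed.

Lemma tp_tdot x y z : (tp x y z)%:R = tdot x y z.
Proof.
by rewrite natr_sum; apply: eq_bigr => i _; rewrite !natrM !F2_natr_nat.
Qed.

Lemma wt_F2 x : (wt x)%:R = \sum_i x i.
Proof. by rewrite natr_sum; apply: eq_bigr => i _; rewrite F2_natr_nat. Qed.

(** The monomials equal to 1 at [x] are the 4-subsets of its support. *)
Lemma S4_hw x : S4 x = 'C(hw x, 2)%:R.
Proof.
pose A := [set i | x i != 0].
have wtA : wt x = #|A|.
  rewrite -sum1_card big_mkcond /=; apply: eq_bigr => i _.
  by rewrite inE; case: (F2_cases (x i)) => ->.
have -> : S4 x = 'C(wt x, 4)%:R.
  rewrite wtA -cards_draws /S4 -sum1_card natr_sum [RHS]big_mkcond /=.
  rewrite [LHS]big_mkcond; apply: eq_bigr => T _; rewrite inE.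
  case: (#|T| == 4)%N; rewrite ?andbF ?andbT //.
  case: (boolP (T \subset A)) => [/fintype.subsetP h|/fintype.subsetPn[i iT]].
    by rewrite big1 // => i /h; rewrite inE => /F2_neq0.
  by rewrite inE negbK => /eqP h; rewrite (bigD1 i) //= h mul0r.
by apply: F2_natr_eq; rewrite odd_bin4.
Qed.

(** For even directions [hwD] expands every half weight by inclusion-exclusion, which leaves the
    parity identity [third_difference_bin2]. *)
Lemma S4_der3 x y z w :
  ~~ odd (wt y) -> ~~ odd (wt z) -> ~~ odd (wt w) ->
  dder (dder (dder (@S4 N) y) z) w x =
  tdot y z w + ((hw w)%:R + dot x w) * dot y z + ((hw z)%:R + dot x z) * dot y w
  + ((hw y)%:R + dot x y) * dot z w
  + (dot y z * dot y w + dot y z * dot z w + dot y w * dot z w).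
Proof.
move=> ey ez ew.
have eyz := wt_evenD ey ez; have eyw := wt_evenD ey ew; have ezw := wt_evenD ez ew.
have eyzw := wt_evenD ey ezw.
(* This removes the even summands of [third_difference_bin2]. *)
have sq (u : 'F_2) : u * u + u = 0.
  by case: (F2_cases u) => ->; rewrite ?mul0r ?mul1r addF2.
have := @third_difference_bin2 (hw x) (hw (x + y)) (hw (x + z)) (hw (x + w))
  (hw (x + (y + z))) (hw (x + (y + w))) (hw (x + (z + w))) (hw (x + (y + (z + w))))
  (hw y) (hw z) (hw w) (ip y z) (ip y w) (ip z w) (ip x y) (ip x z) (ip x w)
  (tp y z w) (tp x y z) (tp x y w) (tp x z w)
  (\sum_i x i * y i * (z i * w i))%N.
have := (hwD x ey, hwD x ez, hwD x ew, hwD x eyz, hwD x eyw, hwD x ezw, hwD x eyzw).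
have := (hwD y ez, hwD y ew, hwD z ew, hwD y ezw).
have := (ipD y z w, ipD x y z, ipD x y w, ipD x z w, ipD x y (z + w), tpD x y z w).
move=> [[[[[i1 i2] i3] i4] i5] i6] [[[k1 k2] k3] k4] [[[[[[l1 l2] l3] l4] l5] l6] l7].
move=> H; have {H}/F2_natr_eq := H ltac:(lia) ltac:(lia) ltac:(lia) ltac:(lia)
   ltac:(lia) ltac:(lia) ltac:(lia).
rewrite !natrD !natrM -!S4_hw !natrD !ip_dot !tp_tdot !sq !addr0 => E.
transitivity (S4 x + S4 (x + y) + S4 (x + z) + S4 (x + w) + S4 (x + (y + z))
   + S4 (x + (y + w)) + S4 (x + (z + w)) + S4 (x + (y + (z + w)))); last first.
  by rewrite E !addrA.
rewrite /dder !oppF2 (addrC y (z + w)) (addrC z w) (addrC y z) (addrC y w) !addrA.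
ring.
Qed.
End Weights.

(** * Functions of bounded degree *)

Section DerivativeOrder.
Variable U : zmodType.
Implicit Types F G : U -> 'F_2.

(** Degree below [k], expressed by iterated derivatives. *)
Fixpoint vanish k F : Prop :=
  if k is k'.+1 then forall y, vanish k' (dder F y) else forall x, F x = 0.

Lemma vanish_ext k F G : F =1 G -> vanish k F -> vanish k G.
Proof.
elim: k F G => [|k IH] F G FG /= h; first by move=> x; rewrite -FG.
by move=> y; apply: IH (h y) => x; rewrite /dder !FG.
Qed.

Lemma vanish0 k : vanish k (fun=> 0).
Proof.
elim: k => [//|k IH] y; apply: vanish_ext IH => x.
by rewrite /dder subrr.
Qed.

Lemma vanishD k F G : vanish k F -> vanish k G -> vanish k (fun x => F x + G x).
Proof.
elim: k F G => [|k IH] F G /= hF hG; first by move=> x; rewrite hF hG addr0.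
by move=> y; apply: vanish_ext (IH _ _ (hF y) (hG y)) => x; rewrite /dder; ring.
Qed.

Lemma vanishZ k (c : 'F_2) F : vanish k F -> vanish k (fun x => c * F x).
Proof.
elim: k F => [|k IH] F /= hF; first by move=> x; rewrite hF mulr0.
by move=> y; apply: vanish_ext (IH _ (hF y)) => x; rewrite /dder; ring.
Qed.

Lemma vanish_shift k F y : vanish k F -> vanish k (fun x => F (x + y)).
Proof.
elim: k F => [|k IH] F /= hF; first by move=> x; rewrite hF.
by move=> z; apply: vanish_ext (IH _ (hF z)) => x; rewrite /dder addrAC.
Qed.

Lemma vanishS k F : vanish k F -> vanish k.+1 F.
Proof.
elim: k F => [|k IH] F hF y; first by move=> x; rewrite /dder !hF subrr.
exact: IH.
Qed.

Lemma vanish_le k l F : (k <= l)%N -> vanish k F -> vanish l F.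
Proof.
move=> /subnK <-; elim: (l - k)%N => [//|n IH] h.
by rewrite addSn; apply: vanishS; exact: IH.
Qed.

(** Leibniz rule: the derivative along [y] is [l x * dder F y x + l y * F (x + y)]. *)
Lemma vanish_mul_additive k (l : U -> 'F_2) F : {morph l : x y / x + y} ->
  vanish k F -> vanish k.+1 (fun x => l x * F x).
Proof.
move=> lD; elim: k F => [|k IH] F hF y.
  by move=> x; rewrite /dder !hF !mulr0 subrr.
apply: vanish_ext (vanishD (IH _ (hF y)) (vanishZ (l y) (vanish_shift y hF))) => x.
by rewrite /dder lD; ring.
Qed.

Lemma dderC F y z x : dder (dder F y) z x = dder (dder F z) y x.
Proof. by rewrite /dder (addrAC x z y); ring. Qed.

Lemma dderD F y z x : dder F (y + z) x = dder F y (x + z) + dder F z x.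
Proof. by rewrite /dder (addrC y) addrA addrA subrK. Qed.

Lemma dder2 F y x : y + y = 0 -> dder (dder F y) y x = 0.
Proof. by move=> h; rewrite /dder -(addrA x) h addr0 !oppF2 [F x + _]addrC addF2. Qed.

Section Cubic.
Variable g : U -> 'F_2.
Hypothesis g4 : vanish 4 g.

(** The polarization of a cubic; by [der3_const] the base point 0 is immaterial. *)
Definition polar3 (y z w : U) := dder (dder (dder g y) z) w 0.

Lemma der3_const x y z w : dder (dder (dder g y) z) w x = polar3 y z w.
Proof.
have /eqP := g4 y z w x 0; rewrite {1}/dder add0r subr_eq0 => /eqP.
exact.
Qed.

Lemma polar3C12 y z w : polar3 y z w = polar3 z y w.
Proof. by rewrite /polar3 /dder; rewrite ![_ + z + y]addrAC; ring. Qed.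

Lemma polar3C23 y z w : polar3 y z w = polar3 y w z.
Proof. exact: dderC. Qed.

Lemma polar3D3 y z : {morph polar3 y z : w w' / w + w'}.
Proof. by move=> w w'; rewrite {1}/polar3 dderD !der3_const. Qed.

Lemma polar3D2 y w : {morph (polar3 y)^~ w : z z' / z + z'}.
Proof. by move=> z z'; rewrite !(polar3C23 y _ w) polar3D3. Qed.

(** Differentiating twice along an element of order two gives 0. Hence [g] does not affect the
    diagonal of [f]. *)
Lemma polar3_diag y w : y + y = 0 -> polar3 y y w = 0.
Proof. by move=> h; rewrite /polar3 {1}/dder !dder2 // subrr. Qed.
End Cubic.
End DerivativeOrder.

(** An arbitrary list of variables lets the induction peel off one variable, then one power, at a
    time. *)
Lemma monomial_vanish N (I : Type) (s : seq I) (v : I -> 'I_N) (e : I -> nat) :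
  vanish (\sum_(i <- s) e i)%N.+1 (fun x : pt N => \prod_(i <- s) x (v i) ^+ e i).
Proof.
elim: s => [|i s IH].
  have h : vanish 1 (fun _ : pt N => 1) by move=> y x; rewrite /dder subrr.
  by rewrite big_nil; apply: vanish_ext h => x; rewrite big_nil.
suff h n : vanish (n + \sum_(j <- s) e j)%N.+1
    (fun x : pt N => x (v i) ^+ n * \prod_(j <- s) x (v j) ^+ e j).
  by rewrite big_cons; apply: vanish_ext (h _) => x; rewrite big_cons.
elim: n => [|n IHn]; first by apply: vanish_ext IH => x; rewrite mul1r.
have lD : {morph (fun x : pt N => x (v i)) : x y / x + y}.
  by move=> x y; rewrite ffunE.
by apply: vanish_ext (vanish_mul_additive lD IHn) => x; rewrite exprS mulrA.
Qed.

Lemma peval_vanish N (g : mpoly.mpoly N 'F_2) :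
  vanish (mdegree g).+1 (peval g).
Proof.
suff h : vanish (mdegree g).+1 (fun x : pt N => \sum_(m <- mpoly.msupp g)
    mpoly.mcoeff m g * \prod_i x i ^+ mpoly.fun_of_multinom m i).
  by apply: vanish_ext h => x; rewrite /peval mpoly.mevalE.
rewrite /mdegree; elim: (mpoly.msupp g) => [|m s IH].
  by apply: vanish_ext (vanish0 _ _) => x; rewrite big_nil.
rewrite big_cons; set k := maxn _ _.
have h1 : vanish k.+1 (fun x : pt N =>
    mpoly.mcoeff m g * \prod_i x i ^+ mpoly.fun_of_multinom m i).
  apply: vanishZ; apply: vanish_le (monomial_vanish _ id _).
  by rewrite ltnS -mpoly.mdegE leq_maxl.
have h2 : (\max_(m <- s) mpoly.mdeg m < k.+1)%N by rewrite ltnS leq_maxr.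
by apply: vanish_ext (vanishD h1 (vanish_le h2 IH)) => x; rewrite big_cons.
Qed.

(** * Restriction to even-weight vectors *)

Section EvenProjection.
Variable n : nat.
Local Notation V := (pt n.+1).
Implicit Types x y z w : V.

Lemma pt_char2 x : x + x = 0.
Proof. by apply/ffunP => i; rewrite !ffunE addF2. Qed.

Lemma dotC x y : dot x y = dot y x.
Proof. by apply: eq_bigr => i _; rewrite mulrC. Qed.

Lemma dotD x : {morph dot x : y z / y + z}.
Proof.
by move=> y z; rewrite /dot -big_split; apply: eq_bigr => i _; rewrite ffunE mulrDr.
Qed.

Lemma tdotD3 x y : {morph tdot x y : z w / z + w}.
Proof.
by move=> z w; rewrite /tdot -big_split; apply: eq_bigr => i _; rewrite ffunE mulrDr.
Qed.

Lemma tdotC12 x y z : tdot x y z = tdot y x z.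
Proof. by apply: eq_bigr => i _; rewrite (mulrC (x i)). Qed.

Lemma tdotC23 x y z : tdot x y z = tdot x z y.
Proof. by apply: eq_bigr => i _; rewrite mulrAC. Qed.

Lemma tdot_diag x y : tdot x x y = dot x y.
Proof.
apply: eq_bigr => i _; congr (_ * _).
by case: (F2_cases (x i)) => ->; rewrite ?mulr0 ?mulr1.
Qed.

(* Projection onto the even-weight vectors along the first basis vector. *)
Definition evp y : V := [ffun i => y i + (i == ord0)%:R * \sum_j y j].

Lemma evpD : {morph evp : y z / y + z}.
Proof.
move=> y z; apply/ffunP => i; rewrite !ffunE.
under eq_bigr => j _ do rewrite ffunE.
by rewrite big_split /=; ring.
Qed.

Lemma sum_indicator (a : 'I_n.+1) (F : 'I_n.+1 -> 'F_2) :
  \sum_i (i == a)%:R * F i = F a.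
Proof.
rewrite (bigD1 a) //= eqxx mul1r big1 ?addr0 // => i /negbTE ->.
by rewrite mul0r.
Qed.

Lemma evp_even y : ~~ odd (wt (evp y)).
Proof.
have : (wt (evp y))%:R = 0 :> 'F_2.
  rewrite wt_F2; under eq_bigr => i _ do rewrite ffunE.
  by rewrite big_split /= (sum_indicator _ (fun=> _)) addF2.
by rewrite F2_nat_odd; case: (odd _).
Qed.

(** [evp] adds the first unit vector to the [i]-th, so the pairing reads off two coordinates of
    [evp y]. *)
Lemma dot_evp_unit y i : i != ord0 ->
  dot (evp y) (evp [ffun j => (j == i)%:R]) = y i + evp y ord0.
Proof.
move=> i0; rewrite /dot.
under eq_bigr => j _.
  rewrite [in X in _ * X]ffunE (_ : \sum_k _ = 1); last first.
    under eq_bigr => k _ do rewrite ffunE -[_%:R]mulr1.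
    exact: (sum_indicator _ (fun=> 1)).
  rewrite [X in _ * (X + _)]ffunE mulr1 mulrC mulrDl; over.
rewrite big_split /= !sum_indicator; congr (_ + _).
by rewrite ffunE (negbTE i0) mul0r addr0.
Qed.

(** By [dot_evp_unit] the functional determines [y] once the bits [y ord0] and [evp y ord0] are
    known. *)
Lemma dot_evp_fibre (c : {ffun V -> 'F_2}) :
  (\sum_y ([ffun x => dot (evp y) (evp x)] == c) <= 4)%N.
Proof.
rewrite -big_mkcond sum1dep_card.
pose h y : 'F_2 * 'F_2 := (y ord0, evp y ord0).
rewrite -(@card_in_imset _ _ h).
  by apply: leq_trans (max_card _) _; rewrite card_prod card_Fp.
move=> y y'; rewrite !inE => /eqP/ffunP h1 /eqP/ffunP h2 [h3 h4].
apply/ffunP => i; have [->//|i0] := eqVneq i ord0.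
have := h1 [ffun j => (j == i)%:R]; rewrite -h2 !ffunE !dot_evp_unit //.
by rewrite h4 => /addIr.
Qed.

Variable R : realType.
Local Notation M := (#|{: V}|%:R : R).

Lemma shifted_sum_bound (g : V -> 'F_2) (x0 : V) : vanish 4 g ->
  csum R (fun v => S4 (x0 + evp v) - g (x0 + evp v)) ^+ 24 <= 2 ^+ 19 * M ^+ 23.
Proof.
move=> g4; pose T := polar3 g.
(* All forms are pulled back along [evp] to the whole group, where each even vector is hit twice. *)
pose B y z := dot (evp y) (evp z).
pose f y z w := tdot (evp y) (evp z) (evp w) - T (evp y) (evp z) (evp w).
(* The part of the third derivative that is constant in [x], from [S4_der3] at [x0 + evp x]. *)
pose Phi y z w := tdot (evp y) (evp z) (evp w)
  + ((hw (evp w))%:R + dot x0 (evp w)) * B y z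
  + ((hw (evp z))%:R + dot x0 (evp z)) * B y w
  + ((hw (evp y))%:R + dot x0 (evp y)) * B z w
  + (B y z * B y w + B y z * B z w + B y w * B z w)
  - T (evp y) (evp z) (evp w).
have [] := @quartic_sum_bound R V B f Phi
  (fun v => S4 (x0 + evp v) - g (x0 + evp v)) 4.
- exact: pt_char2.
- by move=> x y; exact: dotC.
- by move=> x y z; rewrite /B evpD dotD.
- exact: dot_evp_fibre.
- by move=> y z w; rewrite /f tdotC12 /T polar3C12.
- move=> y w z z'; rewrite /f evpD /T polar3D2 //.
  by rewrite !(tdotC23 _ _ (evp w)) tdotD3; ring.
- by move=> y z w w'; rewrite /f evpD /T polar3D3 // tdotD3; ring.
- by move=> y w; rewrite /f tdot_diag /T polar3_diag ?subr0 ?pt_char2.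
- move=> x y z w.
  transitivity (dder (dder (dder (@S4 n.+1) (evp y)) (evp z)) (evp w) (x0 + evp x)
    - dder (dder (dder g (evp y)) (evp z)) (evp w) (x0 + evp x)).
    by rewrite /dder !evpD !addrA; ring.
  rewrite (der3_const g4) S4_der3 ?evp_even // !(dotC (x0 + _)) !dotD.
  rewrite !(dotC _ x0) !(dotC _ (evp x)) /Phi /B /T; ring.
- by move=> y z w; rewrite /Phi /f => -> -> ->; rewrite !mulr0 !addr0.
move=> K [hK hS].
have M1 : 1 <= M by rewrite ler1n; apply/card_gt0P; exists 0.
have {}hK : K%:R ^+ 3 <= 4 * M ^+ 5 by rewrite -!natrX -natrM ler_nat.
have K0 : 0 <= K%:R :> R by [].
(* The eighth power is cubed to use the bound on [K ^ 3]. *)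
rewrite (exprM _ 8 3); set S := csum R _ in hS *.
have S0 : 0 <= S ^+ 8 by rewrite (exprM _ 4 2) sqr_ge0.
apply: (@le_trans _ _ ((M ^+ 6 * (K%:R + 12 * 4 * M)) ^+ 3)).
  by rewrite lerXn2r // nnegrE (le_trans S0).
move: M1 hK K0; move: M K%:R => m k m1 hK k0.
have m35 : m ^+ 3 <= m ^+ 5 by rewrite ler_weXn2l.
have h : (k + 12 * 4 * m) ^+ 3 <= 4 * (k ^+ 3 + (48 * m) ^+ 3).
  set l := 48 * m; have -> : 12 * 4 * m = l by rewrite /l; ring.
  have l0 : 0 <= l by rewrite /l; lra.
  rewrite -subr_ge0.
  have -> : 4 * (k ^+ 3 + l ^+ 3) - (k + l) ^+ 3 = 3 * ((k + l) * (k - l) ^+ 2) by ring.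
  by rewrite mulr_ge0 // mulr_ge0 ?sqr_ge0 // addr_ge0.
rewrite exprMn -exprM (_ : 2 ^+ 19 * m ^+ 23 = m ^+ (6 * 3) * (2 ^+ 19 * m ^+ 5)); last by ring.
rewrite ler_wpM2l ?exprn_ge0 //; first by lra.
have m5 : 0 <= m ^+ 5 by rewrite exprn_ge0 //; lra.
(* The constant is 4 * (4 + 48^3) = 442384, below 2^19. *)
apply: (le_trans h); rewrite exprMn; lra.
Qed.
End EvenProjection.

(** * Averaging over translates, and the constants *)

Theorem theorem1p3 (R : realType) :
  exists (alpha : R) (N0 : nat), 0 < alpha /\
    forall (N : nat) (g : mpoly.mpoly N 'F_2),
      (N0 <= N)%N -> (mdegree g <= 3)%N ->
      `| corr R (@S4 N) (peval g) | < expR (- (alpha * N%:R)).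
Proof.
(* This [alpha] gives [e ^+ 48 = M^-1]. Squaring [shifted_sum_bound] gives 2^38 M^46, which is below
   M^47 once 2^38 < M = 2^N, hence 39. *)
exists (ln 2 / 48), 39%N; split; first by rewrite divr_gt0 ?ln_gt0 ?ltr1n.
case=> [//|n] g N39 g3.
have g4 : vanish 4 (peval g) by apply: vanish_le (peval_vanish g).
set e := expR _; pose V := pt n.+1; pose M : R := #|{: V}|%:R.
have ME : M = 2 ^+ n.+1.
  by rewrite /M card_ffun card_Fp // card_ord natrX.
have M0 : 0 < M by rewrite ME exprn_gt0.
have e0 : 0 < e by exact: expR_gt0.
have e48 : e ^+ 48 = M^-1.
  rewrite -expRM_natl ME; transitivity (expR (- (ln 2 * n.+1%:R)) : R).
    by congr expR; field.
  by rewrite expRN expRM_natr lnK ?posrE.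
pose S x := csum R (fun v : V => S4 (x + evp v) - peval g (x + evp v)).
have hS x : `|S x| < M * e.
  rewrite -(@ltr_pXn2r _ 48) ?nnegrE ?normr_ge0 ?(mulr_ge0 (ltW M0) (ltW e0)) //.
  rewrite exprMn e48 -normrX ger0_norm ?(exprM _ 24 2) ?sqr_ge0 //.
  have := shifted_sum_bound R x g4; rewrite -/M -/(S x) => h.
  have h0 : 0 <= S x ^+ 24 by rewrite (exprM _ 12 2) sqr_ge0.
  apply: (@le_lt_trans _ _ ((2 ^+ 19 * M ^+ 23) ^+ 2)).
    by rewrite lerXn2r // nnegrE (le_trans h0).
  rewrite -exprM (exprSr M 47) mulfK ?gt_eqF // exprMn -!exprM (exprS M 46).
  by rewrite ltr_pM2r ?exprn_gt0 // ME ltr_eXn2l // ltr1n.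
(* For each fixed [v], translation by [evp v] permutes the points, so every [v] contributes the full
   sum. *)
have sumS : \sum_x S x = M * \sum_(x : V) sgnF2 R (S4 x - peval g x).
  rewrite /S /csum exchange_big /= /M mulr_natl -sumr_const; apply: eq_bigr => v _.
  by rewrite [RHS](reindex_inj (addIr (evp v))).
rewrite /corr -/M normrM normfV (gtr0_norm M0) mulrC ltr_pdivrMr // (mulrC e).
rewrite -(ltr_pM2l M0) -{1}(gtr0_norm M0) -normrM -sumS.
apply: le_lt_trans (ler_norm_sum _ _ _) _.
rewrite {1}/M mulr_natl -sumr_const; apply: ltr_sum => [|x _]; last exact: hS.
by apply/hasP; exists 0; rewrite ?mem_index_enum.
Qed.
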